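(* Let $1\le k\le n$ and $0\le\ell\le n$ be integers. Then the Plücker forms $\{P_I\}_{I\in\mathbf{I}_{k,n}}\subset\mathbb{K}[x_{i,j}]$ form a SAGBI basis for the Plücker algebra $\mathcal{A}_{k,n}$ with respect to the weight arising from the block diagonal matching field $\mathcal{B}_\ell$ (i.e. the weight given by the matrix $M_\ell$).
   Context: $\mathbb{K}$ is a field of characteristic $0$, $[n]=\{1,\dots,n\}$, $\mathbf{I}_{k,n}$ is the set of $k$-subsets of $[n]$, and $X=(x_{i,j})$ is a $k\times n$ matrix of indeterminates. The Plücker form $P_I\in\mathbb{K}[x_{i,j}]$ is the maximal minor of $X$ with column set $I$. The Plücker algebra $\mathcal{A}_{k,n}$ is the subalgebra of $\mathbb{K}[x_{i,j}]$ generated by all $P_I$, $I\in\mathbf{I}_{k,n}$. The block diagonal matching field $\mathcal{B}_\ell:\mathbf{I}_{k,n}\to S_k$ has $\mathcal{B}_\ell(I)=\mathrm{id}$ if $|I|=1$ or $|I\cap\{1,\dots,\ell\}|\ne1$, and $\mathcal{B}_\ell(I)=(1\,2)$ otherwise. It is induced by the $k\times n$ weight matrix $M_\ell$ whose first row is $0$; whose second row has entry $\ell+1-j$ in column $j\le\ell$ and entry $n+\ell+1-j$ in column $j>\ell$; and whose $i$-th row, for $i\ge3$, has entry $(i-1)(n+1-j)$ in column $j$. Here ''induced'' means that, with initial forms as defined next, the initial form of $P_I$ is $\operatorname{sgn}(\sigma)\,x_{\sigma(1),i_1}\cdots x_{\sigma(k),i_k}$ for $I=\{i_1<\dots<i_k\}$,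 $\sigma=\mathcal{B}_\ell(I)$. Initial forms: the weight of a monomial in the $x_{i,j}$ is the sum (with multiplicity) of the entries of $M_\ell$ at the positions of its variables, and the initial form $\operatorname{in}(f)$ of $f\in\mathbb{K}[x_{i,j}]$ is the sum of the terms of $f$ of lowest weight. SAGBI basis: $\operatorname{in}(\mathcal{A}_{k,n})$ is the algebra generated by all $\operatorname{in}(f)$, $f\in\mathcal{A}_{k,n}$, and $A_\ell=\mathbb{K}[\operatorname{in}(P_I)]_{I\in\mathbf{I}_{k,n}}$. The set $\{P_I\}$ is a SAGBI basis for $\mathcal{A}_{k,n}$ if each $\operatorname{in}(P_I)$ is a monomial (up to a nonzero scalar) and $\operatorname{in}(\mathcal{A}_{k,n})=A_\ell$. *)

(* Defs.v *)
From HB Require Import structures.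
From mathcomp Require Import all_boot all_order all_fingroup all_algebra.
From mathcomp.multinomials Require Import mpoly.
From mathcomp Require Import zify ring.

Set Implicit Arguments.
Unset Strict Implicit.
Unset Printing Implicit Defensive.

Import GRing.Theory.
Local Open Scope ring_scope.

(* Rows, columns and elements of [n] are numbered from 0: the index i : 'I_n
   stands for i + 1 in [n]. *)

Definition ksubset (k n : nat) := {I : {set 'I_n} | #|I| == k}.

(* [enum] lists a set of ordinals in increasing order, so [kcol I c] is the
   element i_{c+1} of I = {i_1 < ... < i_k}; see [kcol_lt]. *)
Definition kcol k n (I : ksubset k n) (c : 'I_k) : 'I_n :=
  enum_val (cast_ord (esym (eqP (valP I))) c).

(* The variable x_{i,j}; [mxvec_index] is a bijection 'I_k * 'I_n -> 'I_(k * n).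
*)
Definition xvar (K : fieldType) k n (i : 'I_k) (j : 'I_n) : {mpoly K[k * n]} :=
  'X_(mxvec_index i j).

Definition generic_mx (K : fieldType) k n : 'M[{mpoly K[k * n]}]_(k, n) :=
  \matrix_(i, j) xvar K i j.

Definition plucker (K : fieldType) k n (I : ksubset k n) : {mpoly K[k * n]} :=
  \det (colsub (kcol I) (generic_mx K k n)).

(* The K-subalgebra of A generated by S. *)
Inductive gen_subalg (K : fieldType) (A : algType K) (S : A -> Prop) :
    A -> Prop :=
| GenIncl f of S f : gen_subalg S f
| GenScalar c : gen_subalg S c%:A
| GenAdd f g of gen_subalg S f & gen_subalg S g : gen_subalg S (f + g)
| GenMul f g of gen_subalg S f & gen_subalg S g : gen_subalg S (f * g).

Definition plucker_algebra (K : fieldType) k n : {mpoly K[k * n]} -> Prop :=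
  gen_subalg (fun f => exists I : ksubset k n, f = plucker K I).

Definition monom_weight k n (M : 'M[nat]_(k, n)) (m : 'X_{1..k * n}) : nat :=
  (\sum_(i < k) \sum_(j < n) M i j * m (mxvec_index i j))%N.

(* The sum of the terms of lowest weight of f (0 when f = 0). *)
Definition initial_form (K : fieldType) k n (M : 'M[nat]_(k, n))
    (f : {mpoly K[k * n]}) : {mpoly K[k * n]} :=
  \sum_(m <- msupp f |
        all (fun m' => monom_weight M m <= monom_weight M m')%N (msupp f))
     f@_m *: 'X_[m].

Definition initial_algebra (K : fieldType) k n (M : 'M[nat]_(k, n))
    (A : {mpoly K[k * n]} -> Prop) : {mpoly K[k * n]} -> Prop :=
  gen_subalg (fun g => exists2 f, A f & g = initial_form M f).

Definition scaled_monomial (K : fieldType) N (f : {mpoly K[N]}) : Prop :=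
  exists2 c : K, c != 0 & exists m : 'X_{1..N}, f = c *: 'X_[m].

Definition sagbi_basis (K : fieldType) k n (M : 'M[nat]_(k, n)) (J : Type)
    (F : J -> {mpoly K[k * n]}) (A : {mpoly K[k * n]} -> Prop) : Prop :=
  (forall j, scaled_monomial (initial_form M (F j))) /\
  (forall g, initial_algebra M A g <->
     gen_subalg (fun h => exists j, h = initial_form M (F j)) g).

(* The transposition (1 2) of S_k, meaningful for k >= 2 only. *)
Definition swap12 k : 'S_k :=
  match k with
  | k'.+2 => tperm ord0 (lift ord0 ord0)
  | _ => 1%g
  end.

Definition block_field k n (l : nat) (I : ksubset k n) : 'S_k :=
  if (#|val I| == 1%N) || (#|[set j in val I | (j < l)%N]| != 1%N) then 1%g
  else swap12 k.

(* In 1-based indices: the second row is l + 1 - j for j <= l and n + l + 1 - j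
   for j > l, and the row i >= 3 is (i - 1)(n + 1 - j).  No subtraction below is
   truncated. *)
Definition block_weight k n (l : nat) : 'M[nat]_(k, n) :=
  \matrix_(i < k, j < n)
    (match nat_of_ord i with
     | 0 => 0
     | 1 => if j < l then l - j else n + l - j
     | _ => i * (n - j)
     end)%N.

Definition induces (K : fieldType) k n (M : 'M[nat]_(k, n))
    (B : ksubset k n -> 'S_k) : Prop :=
  forall I : ksubset k n,
    initial_form M (plucker K I) =
      (-1) ^+ B I *: \prod_(c < k) xvar K (B I c) (kcol I c).

(* The rest of this file proves [block_weight_induces]: the weight matrix
   [block_weight k n l] induces the block diagonal matching field. *)

Section PermutationWeight.

Variables (k : nat) (p : 'I_k -> nat).
Hypothesis p_decr : forall c d : 'I_k, (c < d)%N -> (p d < p c)%N.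

Let R (s : 'S_k) : nat := (\sum_(i < k) i * p (s i))%N.

Lemma incr_leq (f : 'I_k -> 'I_k) :
  (forall i j : 'I_k, (i < j)%N -> (f i < f j)%N) -> forall i : 'I_k, (i <= f i)%N.
Proof.
move=> f_incr [i lt_ik]; elim: i lt_ik => [//|i IHi] lt_ik /=.
have lt_ik' : (i < k)%N by apply: ltn_trans lt_ik.
apply: leq_ltn_trans (IHi lt_ik') _; exact: f_incr.
Qed.

Lemma perm_inversion (s : 'S_k) :
  s != 1%g -> exists i j : 'I_k, (i < j)%N /\ (s j < s i)%N.
Proof.
move=> s_neq1.
have [/existsP[i /existsP[j /andP[ltij ltsji]]] | noinv] :=
  boolP [exists i : 'I_k, [exists j : 'I_k, (i < j)%N && (s j < s i)%N]].
  by exists i, j.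
have s_incr (i j : 'I_k) : (i < j)%N -> (s i < s j)%N.
  move=> ltij; rewrite ltn_neqAle leqNgt; apply/andP; split.
    by apply/eqP => /val_inj/perm_inj eij; rewrite eij ltnn in ltij.
  apply/negP => ltsji; case/negP: noinv.
  by apply/existsP; exists i; apply/existsP; exists j; rewrite ltij.
have sV_incr (i j : 'I_k) : (i < j)%N -> ((s^-1)%g i < (s^-1)%g j)%N.
  move=> ltij; case: (ltngtP ((s^-1)%g i) ((s^-1)%g j)) => // [gtV | eqV].
    by have := s_incr _ _ gtV; rewrite !permKV ltnNge ltnW.
  by have /perm_inj eij := val_inj eqV; rewrite eij ltnn in ltij.
case/negP: s_neq1; apply/eqP/permP => i; rewrite perm1; apply/val_inj/eqP.
rewrite eqn_leq (incr_leq s_incr) andbT.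
by have := incr_leq sV_incr (s i); rewrite permK.
Qed.

Lemma sum_two (F : 'I_k -> nat) (i j : 'I_k) : i != j ->
  (\sum_x F x = F i + (F j + \sum_(x | (x != i) && (x != j)) F x))%N.
Proof. by move=> neij; rewrite (bigD1 i) //= (bigD1 j) //= eq_sym. Qed.

Lemma sum_tperm (s : 'S_k) (i j : 'I_k) : i != j ->
  (R (tperm i j * s)%g + (i * p (s i) + j * p (s j)) =
   R s + (i * p (s j) + j * p (s i)))%N.
Proof.
move=> neij; rewrite /R !(sum_two _ neij) !permM tpermL tpermR.
rewrite (eq_bigr (fun x : 'I_k => x * p (s x))%N); first by rewrite /=; ring.
by move=> x /andP[nxi nxj]; rewrite permM tpermD // eq_sym.
Qed.

Lemma R_min (s : 'S_k) : s != 1%g -> (R 1 < R s)%N.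
Proof.
pose s0 := [arg min_(t < 1%g : 'S_k) R t].
have R_s0 t : (R s0 <= R t)%N by rewrite /s0; case: arg_minnP => // u _; apply.
have min_id t : (forall u, (R t <= R u)%N) -> t = 1%g.
  move=> min_t; apply/eqP/negPn/negP => /perm_inversion[i [j [ltij ltji]]].
  have neij : i != j by apply: contraTneq ltij => ->; rewrite ltnn.
  have := min_t (tperm i j * t)%g; have := sum_tperm t neij.
  by have := p_decr ltji; nia.
have s0E : s0 = 1%g by apply: min_id.
move=> s_neq1; rewrite ltnNge; apply: contra s_neq1 => le_s1.
by apply/eqP/min_id => u; apply: leq_trans le_s1 _; rewrite -s0E.
Qed.

End PermutationWeight.

Lemma kcol_lt k n (I : ksubset k n) (c d : 'I_k) :
  (c < d)%N -> (kcol I c < kcol I d)%N.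
Proof.
move=> ltcd; have x0 : 'I_n := kcol I c.
rewrite /kcol !(enum_val_nth x0) /=.
have szE : size (enum (val I)) = k by rewrite -cardE (eqP (valP I)).
have sorted_I : sorted ltn (map val (enum (val I))).
  apply: (subseq_sorted ltn_trans) (iota_ltn_sorted 0 n).
  by rewrite -val_enum_ord map_subseq // enumT /enum_mem filter_subseq.
have := sorted_ltn_nth ltn_trans 0%N sorted_I.
rewrite -!(nth_map x0 0%N val) ?szE //.
by apply; rewrite // inE size_map szE.
Qed.

Lemma kcol_inj k n (I : ksubset k n) : injective (kcol I).
Proof.
by move=> c d; rewrite /kcol => /enum_val_inj/cast_ord_inj.
Qed.

Lemma mem_kcol k n (I : ksubset k n) c : kcol I c \in val I.
Proof. exact: enum_valP. Qed.

Lemma kcol_surj k n (I : ksubset k n) j :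
  j \in val I -> exists c, j = kcol I c.
Proof.
move=> jI; exists (cast_ord (eqP (valP I)) (enum_rank_in jI j)).
by rewrite /kcol cast_ordK enum_rankK_in.
Qed.

Section PluckerTerms.

Variables (K : fieldType) (k n : nat) (M : 'M[nat]_(k, n)) (I : ksubset k n).

Let mon (s : 'S_k) : 'X_{1..k * n} :=
  (\sum_(i < k) U_(mxvec_index i (kcol I (s i))))%MM.

Lemma mxvec_index_eq (i i' : 'I_k) (j j' : 'I_n) :
  (mxvec_index i j == mxvec_index i' j') = (i == i') && (j == j').
Proof.
have [g gK _] := curry_mxvec_bij k n.
have inj : injective (uncurry (@mxvec_index k n)).
  by move=> x y e; rewrite -[x]gK // -[y]gK // e.
by rewrite -xpair_eqE -(inj_eq inj).
Qed.

Lemma mon_coef s i c : mon s (mxvec_index i (kcol I c)) = (s i == c).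
Proof.
rewrite /mon mnm_sumE (bigD1 i) //= big1 => [|i' nei'].
  by rewrite addn0 mnm1E mxvec_index_eq eqxx (inj_eq (@kcol_inj _ _ I)).
by rewrite mnm1E mxvec_index_eq (negPf nei').
Qed.

Lemma mon_inj : injective mon.
Proof.
move=> s t e; apply/permP => i; apply/esym/eqP.
by have := mon_coef s i (s i); rewrite e mon_coef eqxx; case: eqP.
Qed.

Lemma mon_weight s : monom_weight M (mon s) = (\sum_i M i (kcol I (s i)))%N.
Proof.
rewrite /monom_weight; apply: eq_bigr => i _.
rewrite (bigD1 (kcol I (s i))) //= mon_coef eqxx muln1 big1 ?addn0 // => j nej.
rewrite /mon mnm_sumE big1 ?muln0 // => i' _.
rewrite mnm1E mxvec_index_eq; case: eqP => // ->.
by rewrite eq_sym (negPf nej).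
Qed.

Lemma plucker_terms :
  plucker K I = \sum_(s : 'S_k) (-1) ^+ s *: 'X_[mon s].
Proof.
rewrite /plucker /determinant; apply: eq_bigr => s _.
rewrite /mon (big_morph _ (@mpolyXD _ K) (mpolyX0 _ K)) -mul_mpolyC rmorphXn rmorphN1; congr (_ * _).
by apply: eq_bigr => i _; rewrite !mxE.
Qed.

Lemma plucker_coef m :
  (plucker K I)@_m = \sum_(s : 'S_k | mon s == m) (-1) ^+ s.
Proof.
rewrite plucker_terms raddf_sum /= [RHS]big_mkcond; apply: eq_bigr => s _.
by rewrite mcoeffZ mcoeffX; case: eqP => _; rewrite ?mulr1 ?mulr0.
Qed.

Lemma plucker_coef_mon s : (plucker K I)@_(mon s) = (-1) ^+ s.
Proof.
by rewrite plucker_coef (big_pred1 s) // => t; rewrite /= (inj_eq mon_inj).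
Qed.

Lemma msupp_plucker m :
  m \in msupp (plucker K I) <-> exists s, m = mon s.
Proof.
rewrite mcoeff_msupp; split=> [|[s ->]]; last first.
  by rewrite plucker_coef_mon signr_eq0.
rewrite plucker_coef => nz.
have [/existsP[s /eqP <-]|no] := boolP [exists s, mon s == m]; first by exists s.
case/eqP: nz; rewrite big_pred0 // => s; apply: contraNF no => ms.
by apply/existsP; exists s.
Qed.

Lemma initial_form_plucker (s : 'S_k) :
  (forall t, t != s -> 
     (\sum_i M i (kcol I (s i)) < \sum_i M i (kcol I (t i)))%N) ->
  initial_form M (plucker K I) = (-1) ^+ s *: \prod_i xvar K i (kcol I (s i)).
Proof.
move=> s_min; rewrite /initial_form.
have ms : mon s \in msupp (plucker K I) by apply/msupp_plucker; exists s.
rewrite big_mkcond (bigD1_seq (mon s)) ?msupp_uniq //=.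
rewrite [X in if X then _ else _](_ : _ = true); last first.
  apply/allP => _ /msupp_plucker[t ->]; rewrite !mon_weight.
  by have [->|/s_min/ltnW] := eqVneq t s.
rewrite big_seq_cond big1 ?addr0 => [|m /andP[/msupp_plucker[t ->] nets]].
  by rewrite plucker_coef_mon /mon (big_morph _ (@mpolyXD _ K) (mpolyX0 _ K)).
case: ifP => // /allP/(_ _ ms); rewrite !mon_weight leqNgt.
by rewrite s_min //; apply: contraNneq nets => ->.
Qed.

End PluckerTerms.

Lemma block_weight_induces (K : fieldType) k n l :
  (l <= n)%N -> induces K (block_weight k n l) (@block_field k n l).
Proof.
move=> le_ln I.
have [s sE] : {s | s = block_field l I} by exists (block_field l I).
have sV : (s * s = 1)%g.
  rewrite sE /block_field; case: ifP => _; first by rewrite mulg1.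
  by case: (k) => [|[|k']] /=; rewrite ?mulg1 // tperm2.
have -> : \prod_(c < k) xvar K (block_field l I c) (kcol I c) =
          \prod_i xvar K i (kcol I (s i)).
  rewrite (reindex_inj (@perm_inj _ s)) -sE.
  by apply: eq_bigr => i _; rewrite -permM sV perm1.
rewrite -sE; apply: initial_form_plucker => t nets.
case: k I s sE sV t nets => [|[|k]] I s sE sV t nets.
- by case/eqP: nets; apply/permP; case.
- by case/eqP: nets; apply/permP => i; rewrite !ord1.
pose p (c : 'I_k.+2) := (n - kcol I c)%N.
have p_decr (c d : 'I_k.+2) : (c < d)%N -> (p d < p c)%N.
  by move=> /(kcol_lt I); rewrite /p; have := ltn_ord (kcol I d); lia.
pose R (u : 'S_k.+2) := (\sum_(i < k.+2) i * p (u i))%N.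
pose W (u : 'S_k.+2) :=
  (\sum_(i < k.+2) block_weight k.+2 n l i (kcol I (u i)))%N.
rewrite -[X in (X < _)%N]/(W s) -[X in (_ < X)%N]/(W t).
have Rmin (u : 'S_k.+2) : u != 1%g -> (R 1%g < R u)%N by apply: R_min.
pose o1 : 'I_k.+2 := lift ord0 ord0.
have ne01 : ord0 != o1 by [].
have lt01 : (kcol I ord0 < kcol I o1)%N by apply: kcol_lt.
have ltn1 := ltn_ord (kcol I o1).
have case_gt0 (c : 'I_k.+2) : c != ord0 -> c = o1 \/ (o1 < c)%N.
  case: c => [[|[|m]] ltm] // _; last by right.
  by left; apply: val_inj.
have col_ge0 c : (kcol I ord0 <= kcol I c)%N.
  have [->|/case_gt0[->|lt1c]] := eqVneq c ord0; rewrite ?(ltnW lt01) //.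
  by apply/ltnW/kcol_lt/leq_ltn_trans/lt1c.
have col_ge1 c : c != ord0 -> (kcol I o1 <= kcol I c)%N.
  by case/case_gt0 => [->|/(kcol_lt I)/ltnW].
have TE (u : 'S_k.+2) : (W u + n * (kcol I (u o1) < l) = R u + l)%N.
  rewrite /W /R !(sum_two _ ne01) !mxE /=.
  rewrite (eq_bigr (fun i : 'I_k.+2 => i * p (u i))%N); last first.
    by move=> [[|[|i]] lti] /andP[n0 n1]; rewrite !mxE //=.
  rewrite mul0n [bump 0 0]/= mul1n !add0n /p.
  move: (\sum_(i < _ | _) _)%N => S.
  by have := ltn_ord (kcol I (u o1)); case: (ltnP _ l); lia.
clearbody W.
have blockE : [set j in val I | (j < l)%N] =
              kcol I @: [set c | (kcol I c < l)%N].
  apply/setP => j; apply/idP/imsetP; rewrite !inE.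
    by case/andP => /kcol_surj[c ->] ltc; exists c; rewrite ?inE.
  by case=> c; rewrite inE => ltc ->; rewrite mem_kcol.
have cardI : #|val I| == 1%N = false by rewrite (eqP (valP I)).
move: sE; rewrite /block_field cardI /= blockE card_imset; last exact: kcol_inj.
have [/eqP one_c | not_one] := boolP (#|_| == 1%N) => /= sE.
  have [lt0 ge1] : (kcol I ord0 < l)%N /\ (l <= kcol I o1)%N.
    have [c cE] := cards1P (introT eqP one_c).
    have ltc : (kcol I c < l)%N by have := set11 c; rewrite -cE inE.
    have lt0 : (kcol I ord0 < l)%N by apply: leq_ltn_trans ltc.
    split=> //; rewrite leqNgt; apply/negP => lt1.
    have /set1P e0 : ord0 \in [set c] by rewrite -cE inE.
    have /set1P e1 : o1 \in [set c] by rewrite -cE inE.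
    by move: ne01; rewrite e0 e1 eqxx.
  have s1 : s o1 = ord0 by rewrite sE tpermR.
  have s0 : s ord0 = o1 by rewrite sE tpermL.
  have Rs : (R s + p o1 = R 1%g + p ord0)%N.
    have := sum_tperm p 1%g ne01; rewrite -/(R _) mulg1 -[tperm _ _]sE.
    rewrite -/(R _) !perm1.
    by rewrite ![nat_of_ord _]/= /bump /= !mul0n !mul1n !add0n.
  have Ts := TE s; rewrite s1 lt0 in Ts.
  have Tt := TE t.
  have p0 : (p ord0 - p o1 < n)%N by rewrite /p; lia.
  have p01 := p_decr ord0 o1 isT.
  have [t1 | t1] := eqVneq (t o1) ord0.
    rewrite t1 lt0 in Tt.
    suff : (R s < R t)%N by lia.
    have nest : (s * t)%g != 1%g.
      apply: contra nets => /eqP st; apply/eqP.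
      by rewrite -[t]mul1g -sV -mulgA st mulg1.
    have : (R 1%g < R (s * t)%g)%N by exact: Rmin.
    have : (R (s * t)%g + p ord0 = R t + p (t ord0))%N.
      have := sum_tperm p t ne01; rewrite -[tperm _ _]sE t1.
      by rewrite ![nat_of_ord _]/= /bump /= !mul0n !mul1n !add0n.
    move: (R (s * t)%g) => Rst.
    have : (p (t ord0) <= p o1)%N.
      by apply: leq_sub2l; apply: col_ge1; rewrite -[X in _ != X]t1 (inj_eq perm_inj).
    by lia.
  have : (l <= kcol I (t o1))%N by apply: leq_trans ge1 (col_ge1 _ t1).
  rewrite leqNgt => /negPf ge_t; rewrite ge_t in Tt.
  have : (R 1%g <= R t)%N by have [-> //|/Rmin/ltnW] := eqVneq t 1%g.
  by lia.
have Ts := TE s; have Tt := TE t; rewrite sE in nets Ts *.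
have := Rmin _ nets; rewrite perm1 in Ts.
suff : ((kcol I (t o1) < l) <= (kcol I o1 < l))%N.
  by move: Ts Tt; do 2!case: (_ < l)%N; lia.
case lt_t: (kcol I (t o1) < l)%N => //; rewrite lt0b.
have lt0 : (kcol I ord0 < l)%N by apply: leq_ltn_trans lt_t.
rewrite ltnNge; apply: contra not_one => ge1; apply/cards1P; exists ord0.
apply/setP => c; rewrite !inE; have [-> // | n0] := eqVneq c ord0.
by apply/negbTE; rewrite -leqNgt; apply: leq_trans ge1 (col_ge1 _ n0).
Qed.

(* Main.v *)
Require Import Defs.
From mathcomp Require Import all_boot all_order all_fingroup all_algebra.
From mathcomp.multinomials Require Import mpoly.
From mathcomp Require Import zify.

Set Implicit Arguments.
Unset Strict Implicit.
Unset Printing Implicit Defensive.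

(* A tableau is a list S of k-subsets, its columns; write P_S for the product
   of the Plucker forms of its columns.  Under the weight M_l the form P_S has
   the leading monomial [tab_mon l S], up to sign.

   By straightening (Garnir relations), the P_T with T semistandard span the
   Plucker algebra, and for l = 0 their leading monomials are distinct.  In each
   class of tableaux with the same row contents, i.e. the same [tab_mon 0],
   choose a tableau N minimising the sum of the products i_1 i_2 of the first
   two entries of the columns.  By triangularity with respect to the weight M_0
   the P_N still span the algebra.  Minimality makes the pairs (i_1, i_2) of the
   columns of N noncrossing, and a noncrossing family of arcs is determined by
   its opening and closing points for any cyclic rotation of the line, in
   particular for the order l+1 < ... < n < 1 < ... < l which underlies the
   block diagonal field.  Hence [tab_mon l N] determines N: the Plucker algebra
   is spanned by products of Plucker forms with distinct leading monomials for
   M_l, so no cancellation of leading terms can occur. *)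

(** * Noncrossing pairs *)

Section Noncrossing.

Implicit Types (E : seq (nat * nat)) (p q : nat * nat) (l : nat).

(** For the first two entries of a column, numbered from 0, this is the case where [block_field] is
    a transposition. In either case [slot1] and [slot2] are the entries placed in the first and
    second rows. *)
Definition mixed l p := (p.1 < l <= p.2).

Definition slot1 l p := if mixed l p then p.2 else p.1.
Definition slot2 l p := if mixed l p then p.1 else p.2.

(** Arcs may share endpoints or repeat; only p.1 < q.1 < p.2 < q.2 is excluded. *)
Definition noncrossing E :=
  {in E &, forall p q, p.1 < q.1 < p.2 -> q.2 <= p.2}.

Lemma perm_map_count (A B : eqType) (f : A -> B) (P : pred B) (s t : seq A) :
  perm_eq (map f s) (map f t) -> count (P \o f) s = count (P \o f) t.
Proof. by move=> /seq.permP/(_ P); rewrite !count_map. Qed.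

Lemma sub_in_count (A : eqType) (P Q : pred A) (s : seq A) :
  {in s, forall x, P x -> Q x} -> count P s <= count Q s.
Proof.
elim: s => //= x s IHs PQ; apply: leq_add.
  by have := PQ x (mem_head _ _); case: (P x) => // ->.
by apply: IHs => y ys; apply: PQ; rewrite inE ys orbT.
Qed.

Lemma count_disjoint (A : eqType) (P Q R : pred A) (s : seq A) :
  {in s, forall x, (P x : nat) = Q x + R x} -> count P s = count Q s + count R s.
Proof.
elim: s => //= x s IHs e; rewrite IHs => [|y ys]; last by rewrite e // inE ys orbT.
by rewrite e ?mem_head // addnACA.
Qed.

Section Compare.

Variables (l : nat) (E E' : seq (nat * nat)).
Hypothesis E_nc : noncrossing E.
Hypothesis E_lt : {in E, forall p, p.1 < p.2}.
Hypothesis E'_lt : {in E', forall p, p.1 < p.2}.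
Hypothesis eq1 : perm_eq (map (slot1 l) E) (map (slot1 l) E').
Hypothesis eq2 : perm_eq (map (slot2 l) E) (map (slot2 l) E').

(* If some mixed pair of E starts at j then no pair of E below l surrounds j,
   hence the mixed pairs starting at or before j are the second slots up to j
   in excess of the first slots before j.  In E' this excess is a lower bound. *)
Lemma mixed_le j : j < l ->
  count (fun p => mixed l p && (p.1 <= j)) E <=
  count (fun p => mixed l p && (p.1 <= j)) E'.
Proof.
pose X F j := count (fun p => mixed l p && (p.1 <= j)) F.
pose A F j := count (fun p => ~~ mixed l p && (p.1 < j)) F.
pose B F j := count (fun p => ~~ mixed l p && (p.2 <= j)) F.
have AE F i : i < l -> count ((fun x => x < i) \o slot1 l) F = A F i.
  move=> ltil; apply: eq_count => p; rewrite /= /slot1.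
  by case: ifP => // /andP[_ lep]; lia.
have BE F i : count ((fun x => x <= i) \o slot2 l) F = X F i + B F i.
  apply: count_disjoint => p _; rewrite /= /slot2.
  by case: (mixed l p) => //=; rewrite addn0.
have attained q : q \in E -> mixed l q -> q.1 < l -> X E q.1 <= X E' q.1.
  move=> qE mq ltql.
  have leB : B E' q.1 <= A E' q.1.
    by apply: sub_in_count => p /E'_lt lt12 /andP[-> /=]; lia.
  have leA : A E q.1 <= B E q.1.
    apply: sub_in_count => p pE /andP[nmp ltp]; rewrite nmp /= leqNgt.
    apply: contra nmp => ltq; move: mq; rewrite /mixed => mq.
    by have := E_nc pE qE; rewrite ltp ltq => /(_ isT); lia.
  have := perm_map_count (fun x => x < q.1) eq1.
  have := perm_map_count (fun x => x <= q.1) eq2.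
  by rewrite !AE // !BE; lia.
elim: j => [|j IHj] ltjl.
  have [/hasP[q qE /andP[mq /eqP q0]]|] :=
    boolP (has (fun p => mixed l p && (p.1 == 0)) E).
    by have := attained q qE mq; rewrite q0; apply.
  rewrite has_count -leqNgt leqn0 (eq_count (a2 := fun p => mixed l p && (p.1 <= 0))).
    by move=> /eqP->.
  by move=> p; rewrite leqn0.
have XS F : X F j.+1 = X F j + count (fun p => mixed l p && (p.1 == j.+1)) F.
  by apply: count_disjoint => p _; case: (mixed l p) => //=; lia.
(* If no mixed pair of [E] starts at [j.+1], the left count stays as it was at [j], while the right
   one cannot drop. *)
have [/hasP[q qE /andP[mq /eqP qj]]|] :=
  boolP (has (fun p => mixed l p && (p.1 == j.+1)) E).
  by have := attained q qE mq; rewrite qj; apply.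
have := IHj (ltnW ltjl); rewrite has_count -/(X E j) -/(X E' j).
rewrite -[X in _ -> _ -> X <= _]/(X E j.+1).
by rewrite -[X in _ -> _ -> _ <= X]/(X E' j.+1) !XS; lia.
Qed.

End Compare.

(** [mixed_le] holds in both directions, so the cumulative counts agree, and consecutive differences
    isolate a single starting point. *)
Lemma mixed_fst_eq l F F' : 
  noncrossing F -> noncrossing F' ->
  {in F, forall p, p.1 < p.2} -> {in F', forall p, p.1 < p.2} ->
  perm_eq (map (slot1 l) F) (map (slot1 l) F') ->
  perm_eq (map (slot2 l) F) (map (slot2 l) F') ->
  forall j, j < l -> count (fun p => mixed l p && (p.1 == j)) F =
                     count (fun p => mixed l p && (p.1 == j)) F'.
Proof.
move=> nc nc' lt lt' e1 e2 j ltjl.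
pose X F j := count (fun p => mixed l p && (p.1 <= j)) F.
have XE i : i < l -> X F i = X F' i.
  by move=> ltil; apply/anti_leq/andP; split; apply: mixed_le; rewrite // perm_sym.
case: j ltjl => [|j] ltjl.
  have X0 G : count (fun p => mixed l p && (p.1 == 0)) G = X G 0.
    by apply: eq_count => p; rewrite leqn0.
  by rewrite !X0 XE.
have XS G : X G j.+1 = X G j + count (fun p => mixed l p && (p.1 == j.+1)) G.
  by apply: count_disjoint => p _; case: (mixed l p) => //=; lia.
by have := XE _ ltjl; rewrite !XS (XE _ (ltnW ltjl)) => /addnI.
Qed.

Definition rev_pair n p := (n.-1 - p.2, n.-1 - p.1).

(** Reversing the line turns ends into starts: [rev_pair] keeps arcs noncrossing, replaces [l] by
    [n - l] and interchanges the two slots, so [mixed_fst_eq] applies. *)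
Lemma mixed_snd_eq n l F F' : l <= n ->
  noncrossing F -> noncrossing F' ->
  {in F, forall p, p.1 < p.2 < n} -> {in F', forall p, p.1 < p.2 < n} ->
  perm_eq (map (slot1 l) F) (map (slot1 l) F') ->
  perm_eq (map (slot2 l) F) (map (slot2 l) F') ->
  forall j, l <= j < n -> count (fun p => mixed l p && (p.2 == j)) F =
                          count (fun p => mixed l p && (p.2 == j)) F'.
Proof.
move=> le_ln nc nc' lt lt' e1 e2 j /andP[lelj ltjn].
have mixed_rev p : p.1 < p.2 < n -> mixed (n - l) (rev_pair n p) = mixed l p.
  by rewrite /mixed /rev_pair /=; lia.
have lt_rev G : {in G, forall p, p.1 < p.2 < n} ->
    {in map (rev_pair n) G, forall p, p.1 < p.2}.
  by move=> ltG _ /mapP[p /ltG ltp ->] /=; lia.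
have nc_rev G : {in G, forall p, p.1 < p.2 < n} -> noncrossing G ->
    noncrossing (map (rev_pair n) G).
  move=> ltG ncG _ _ /mapP[p pG ->] /mapP[q qG ->] /=.
  by have := ncG q p qG pG; have := ltG p pG; have := ltG q qG; lia.
have s1_rev G : {in G, forall p, p.1 < p.2 < n} ->
    map (slot1 (n - l)) (map (rev_pair n) G) =
    map (fun x => n.-1 - x) (map (slot2 l) G).
  move=> ltG; rewrite -!map_comp; apply/eq_in_map => p /ltG ltp.
  by rewrite /= /slot1 mixed_rev // /slot2; case: ifP.
have s2_rev G : {in G, forall p, p.1 < p.2 < n} ->
    map (slot2 (n - l)) (map (rev_pair n) G) =
    map (fun x => n.-1 - x) (map (slot1 l) G).
  move=> ltG; rewrite -!map_comp; apply/eq_in_map => p /ltG ltp.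
  by rewrite /= /slot2 mixed_rev // /slot1; case: ifP.
have ltj' : n.-1 - j < n - l by lia.
have := mixed_fst_eq (nc_rev _ lt nc) (nc_rev _ lt' nc') (lt_rev _ lt)
  (lt_rev _ lt') _ _ ltj'.
rewrite !s1_rev // !s2_rev // => /(_ (perm_map _ e2) (perm_map _ e1)).
have cE G : {in G, forall p, p.1 < p.2 < n} ->
    count (fun p => mixed (n - l) p && (p.1 == n.-1 - j)) (map (rev_pair n) G) =
    count (fun p => mixed l p && (p.2 == j)) G.
  move=> ltG; rewrite count_map; apply: eq_in_count => p /ltG ltp.
  by rewrite /= mixed_rev //; congr (_ && _); lia.
by rewrite !cE.
Qed.

(** Slot and endpoint counts at [j] differ only by the mixed pairs that start at [j] when j < l, or
    end at [j] when l <= j; both numbers are determined by the slots. *)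
Lemma noncrossing_slots n l F F' : l <= n ->
  noncrossing F -> noncrossing F' ->
  {in F, forall p, p.1 < p.2 < n} -> {in F', forall p, p.1 < p.2 < n} ->
  perm_eq (map (slot1 l) F) (map (slot1 l) F') ->
  perm_eq (map (slot2 l) F) (map (slot2 l) F') ->
  forall j, j < n ->
    count (fun p => p.1 == j) F = count (fun p => p.1 == j) F' /\
    count (fun p => p.2 == j) F = count (fun p => p.2 == j) F'.
Proof.
move=> le_ln nc nc' lt lt' e1 e2 j ltjn.
have c1 := perm_map_count (pred1 j) e1; have c2 := perm_map_count (pred1 j) e2.
pose M1 G := count (fun p => mixed l p && (p.1 == j)) G.
pose M2 G := count (fun p => mixed l p && (p.2 == j)) G.
pose A G := count (fun p => p.1 == j) G.
pose B G := count (fun p => p.2 == j) G.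
rewrite -/(A F) -/(A F') -/(B F) -/(B F').
have [ltjl | lelj] := ltnP j l.
  have : M1 F = M1 F'.
    by apply: mixed_fst_eq => // p => [/lt|/lt'] /andP[].
  have AE G : A G = count (pred1 j \o slot1 l) G + M1 G.
    apply: count_disjoint => p _; rewrite /= /slot1.
    by case: ifPn => mp; rewrite ?addn0 //; move: mp; rewrite /mixed; lia.
  have BE G : count (pred1 j \o slot2 l) G = B G + M1 G.
    apply: count_disjoint => p _; rewrite /= /slot2.
    by case: ifPn => mp; rewrite ?addn0 //; move: mp; rewrite /mixed; lia.
  by move=> eM; rewrite !AE; move: c2; rewrite !BE c1 eM => /addIn ->.
have : M2 F = M2 F'.
  by apply: (@mixed_snd_eq n) => //; rewrite lelj.
have AE G : count (pred1 j \o slot1 l) G = A G + M2 G.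
  apply: count_disjoint => p _; rewrite /= /slot1.
  by case: ifPn => mp; rewrite ?addn0 //; move: mp; rewrite /mixed; lia.
have BE G : B G = count (pred1 j \o slot2 l) G + M2 G.
  apply: count_disjoint => p _; rewrite /= /slot2.
  by case: ifPn => mp; rewrite ?addn0 //; move: mp; rewrite /mixed; lia.
by move=> eM; rewrite !BE; move: c1; rewrite !AE c2 eM => /addIn ->.
Qed.

End Noncrossing.

Import GRing.Theory.
Local Open Scope ring_scope.

(** * Exchange relations *)

Lemma ksubset_ext k n (I J : ksubset k n) : kcol I =1 kcol J -> I = J.
Proof.
have sub (A B : ksubset k n) : kcol A =1 kcol B -> val A \subset val B.
  move=> eAB; apply/subsetP => j /kcol_surj[c ->]; rewrite eAB; exact: mem_kcol.
move=> eIJ; apply/val_inj/eqP; rewrite eqEsubset !sub //.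
Qed.

Lemma inj_kcol_perm k n (f : 'I_k -> 'I_n) : injective f ->
  exists (I : ksubset k n) (s : 'S_k), f =1 kcol I \o s.
Proof.
move=> f_inj.
have cardI : #|f @: [set: 'I_k]| == k by rewrite card_imset // cardsT card_ord.
pose I : ksubset k n := exist (fun A : {set 'I_n} => is_true (#|A| == k)) _ cardI.
have fI c : exists d, f c == kcol I d.
  have [|d fcE] := @kcol_surj k n I (f c); first exact: imset_f.
  by exists d; rewrite fcE.
pose g c := xchoose (fI c).
have gE c : f c = kcol I (g c) by apply/eqP/(xchooseP (fI c)).
have g_inj : injective g by move=> c d e; apply: f_inj; rewrite !gE e.
by exists I, (perm g_inj) => c /=; rewrite permE.
Qed.

(** An inversion of the permutation that sorts [f] would contradict monotonicity, so that
    permutation is the identity. *)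
Lemma incr_kcol k n (f : 'I_k -> 'I_n) :
  (forall c d : 'I_k, (c < d)%N -> (f c < f d)%N) ->
  exists I : ksubset k n, kcol I =1 f.
Proof.
move=> f_incr.
have f_inj : injective f.
  move=> c d e; apply: val_inj; case: (ltngtP c d) => // /f_incr;
  by rewrite e ltnn.
have [I [s fE]] := inj_kcol_perm f_inj.
exists I => c; have [s1|/perm_inversion[i [j [ltij]]]] := eqVneq s 1%g.
  by rewrite fE s1 /= perm1.
by move=> /(kcol_lt I); have := f_incr _ _ ltij; rewrite !fE /=; lia.
Qed.

Definition ksum k n (I : ksubset k n) : nat := (\sum_c kcol I c)%N.

(** Columns may come in any order and repeat, as happens when entries are exchanged between two
    columns of a tableau. *)
Definition col_minor (K : fieldType) k n (f : 'I_k -> 'I_n) : {mpoly K[k * n]} :=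
  \det (colsub f (generic_mx K k n)).

Lemma eq_col_minor (K : fieldType) k n (f g : 'I_k -> 'I_n) :
  f =1 g -> col_minor K f = col_minor K g.
Proof. by move=> fg; congr (\det _); apply/matrixP => i j; rewrite !mxE fg. Qed.

Lemma col_minorM_perm (K : fieldType) k n (f : 'I_k -> 'I_n) (s : 'S_k) :
  col_minor K (f \o s) = (-1) ^+ s * col_minor K f.
Proof.
have -> : col_minor K (f \o s) =
    \det (col_perm s (colsub f (generic_mx K k n))).
  by congr (\det _); apply/matrixP => i j; rewrite !mxE.
by rewrite col_permE det_mulmx det_perm odd_permV mulrC.
Qed.

Lemma col_minorP (K : fieldType) k n (f : 'I_k -> 'I_n) :
  col_minor K f = 0 \/
  exists (I : ksubset k n) (b : bool),
    col_minor K f = (-1) ^+ b * plucker K I /\ ksum I = (\sum_c f c)%N.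
Proof.
have [/injectiveP f_inj|] := boolP (injectiveb f).
  right; have [I [s fE]] := inj_kcol_perm f_inj; exists I, s; split.
    by rewrite (eq_col_minor K fE) col_minorM_perm.
  by rewrite /ksum (reindex_inj (@perm_inj _ s)); apply: eq_bigr => c _; rewrite fE.
case/injectivePn => c [d ned efcd]; left.
rewrite /col_minor -det_tr; apply: (determinant_alternate ned) => i.
by rewrite !mxE efcd.
Qed.

Lemma col_minor_expand (K : fieldType) k n (f : 'I_k -> 'I_n) :
  col_minor K f = \sum_(s : 'S_k) (-1) ^+ s * \prod_c xvar K (s c) (f c).
Proof.
rewrite /col_minor -det_tr; apply: eq_bigr => s _; congr (_ * _).
by apply: eq_bigr => c _; rewrite !mxE.
Qed.

Section Garnir.

Variables (K : fieldType) (k n : nat).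
Hypothesis K0 : [pchar K] =i pred0.

Lemma mpoly_mulrn_eq0 N (f : {mpoly K[N]}) m : f *+ m.+1 = 0 -> f = 0.
Proof.
move=> /eqP; rewrite -scaler_nat scaler_eq0 => /orP[|/eqP //].
by rewrite ((pcharf0P _).1 K0).
Qed.

Variable (h : 'I_k + 'I_k -> 'I_n).

(** [inl] and [inr] mark the positions in two columns filled by [h]; [t] redistributes the entries
    between them. *)
Let shuffled (t : {perm 'I_k + 'I_k}) : {mpoly K[k * n]} :=
  (-1) ^+ t * (col_minor K (fun c => h (t (inl c))) *
               col_minor K (fun c => h (t (inr c)))).

(* After Leibniz expansion of both minors each summand assigns a row to every
   element of W; by pigeonhole two elements share a row, and exchanging them
   changes only the sign. *)
Lemma garnir (W : {set 'I_k + 'I_k}) : (k < #|W|)%N ->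
  \sum_(t | perm_on W t) shuffled t = 0.
Proof.
move=> ltkW.
pose row (s u : 'S_k) (z : 'I_k + 'I_k) : 'I_k :=
  match z with inl c => s c | inr c => u c end.
have expand t : shuffled t = \sum_(s : 'S_k) \sum_(u : 'S_k)
    (-1) ^+ s * (-1) ^+ u * ((-1) ^+ t * \prod_z xvar K (row s u z) (h (t z))).
  rewrite /shuffled !col_minor_expand big_distrl mulr_sumr /=.
  apply: eq_bigr => s _; rewrite big_distrr mulr_sumr /=; apply: eq_bigr => u _.
  by rewrite big_sumType /= mulrACA [LHS]mulrCA.
rewrite (eq_bigr _ (fun t _ => expand t)) exchange_big /= big1 // => s _.
rewrite exchange_big /= big1 // => u _; rewrite -mulr_sumr.
have [z [z' [zW z'W nez eqrow]]] :
    exists z z', [/\ z \in W, z' \in W, z != z' & row s u z = row s u z'].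
  have [/(dinjectiveP) row_inj|] := boolP (dinjectiveb (row s u) (mem W)).
    have := card_in_imset row_inj; have := max_card (mem (row s u @: W)).
    by rewrite card_ord => le_k eqW; rewrite -eqW ltnNge le_k in ltkW.
  by case/dinjectivePn => z zW [z' /andP[nez z'W] e]; exists z, z'; rewrite eq_sym.
set G := \sum_(t | _) _.
suff GN : G = - G.
  have G2 : G *+ 2 = 0 by rewrite mulr2n {2}GN subrr.
  by rewrite (mpoly_mulrn_eq0 G2) mulr0.
rewrite {1}/G (reindex_inj (mulgI (tperm z z'))) /= -sumrN.
have tW : perm_on W (tperm z z').
  by apply: subset_trans (tperm_on z z') _; apply/subsetP => y /set2P[]->.
apply: eq_big => [t|t _].
  apply/idP/idP => [tt|]; last exact: perm_onM.
  by rewrite -[t](mulKg (tperm z z')) tpermV; apply: perm_onM.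
rewrite odd_permM odd_tperm nez signr_addb expr1 !mulN1r mulNr; congr (- (_ * _)).
rewrite (reindex_inj (@perm_inj _ (tperm z z'))) /=.
apply: eq_bigr => y _; rewrite permM tpermK.
by case: tpermP => // ->; rewrite eqrow.
Qed.

End Garnir.

(** * Signs of permutations of a disjoint sum *)

Section LiftSign.

Variable T : finType.

Lemma lift_inl_inj (s : {perm T}) :
  injective (fun z : T + T => match z with inl x => inl (s x) | inr x => inr x end).
Proof. by move=> [x|x] [y|y] //= [/perm_inj->]. Qed.

Lemma lift_inr_inj (s : {perm T}) :
  injective (fun z : T + T => match z with inl x => inl x | inr x => inr (s x) end).
Proof. by move=> [x|x] [y|y] //= [/perm_inj->]. Qed.

(** Both parities are multiplicative and transpositions generate, so comparing them on
    transpositions suffices. *)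
Lemma odd_lift (f : {perm T} -> {perm T + T}) :
  f 1%g = 1%g -> {morph f : s u / (s * u)%g} ->
  (forall x y, x != y -> odd_perm (f (tperm x y))) ->
  forall s, odd_perm (f s) = odd_perm s.
Proof.
move=> f1 fM f_tperm s; have [ts -> /= dts] := prod_tpermP s.
elim: ts dts => [_|[x y] ts IHts /andP[nexy /IHts IH]].
  by rewrite !big_nil f1 !odd_perm1.
by rewrite !big_cons fM !odd_permM IH f_tperm // odd_tperm (nexy : x != y).
Qed.

Lemma odd_lift_inl (s : {perm T}) : odd_perm (perm (@lift_inl_inj s)) = odd_perm s.
Proof.
apply: (@odd_lift (fun u => perm (@lift_inl_inj u))) => [|u v|x y nexy].
- by apply/permP => -[x|x]; rewrite permE !perm1.
- by apply/permP => -[x|x]; rewrite permM !permE //= permM.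
rewrite [perm _](_ : _ = tperm (inl x) (inl y)) ?odd_tperm //.
apply/permP => -[z|z]; rewrite permE; last by rewrite tpermD.
case: tpermP => [->|->|nzx nzy]; rewrite ?tpermL ?tpermR // tpermD //;
by apply/eqP => -[ez]; first [exact: nzx | exact: nzy].
Qed.

Lemma odd_lift_inr (s : {perm T}) : odd_perm (perm (@lift_inr_inj s)) = odd_perm s.
Proof.
apply: (@odd_lift (fun u => perm (@lift_inr_inj u))) => [|u v|x y nexy].
- by apply/permP => -[x|x]; rewrite permE !perm1.
- by apply/permP => -[x|x]; rewrite permM !permE //= permM.
rewrite [perm _](_ : _ = tperm (inr x) (inr y)) ?odd_tperm //.
apply/permP => -[z|z]; rewrite permE; first by rewrite tpermD.
case: tpermP => [->|->|nzx nzy]; rewrite ?tpermL ?tpermR // tpermD //;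
by apply/eqP => -[ez]; first [exact: nzx | exact: nzy].
Qed.

(** By finiteness [t] maps the left summand onto itself, hence also the right one, and is the
    product of the lifts of its two restrictions. *)
Lemma odd_split (t : {perm T + T}) :
  (forall x, exists y, t (inl x) = inl y) ->
  exists s u : {perm T}, [/\ forall x, t (inl x) = inl (s x),
    forall x, t (inr x) = inr (u x) & odd_perm t = odd_perm s (+) odd_perm u].
Proof.
move=> t_inl.
pose f x := if t (inl x) is inl y then y else x.
have fE x : t (inl x) = inl (f x) by rewrite /f; have [y ->] := t_inl x.
have f_inj : injective f by move=> x y e; apply/inl_inj/(@perm_inj _ t); rewrite !fE e.
have t_inr x : exists y, t (inr x) = inr y.
  case e: (t (inr x)) => [y|y]; last by exists y.
  have [z zy] : exists z, f z = y by exists (invF f_inj y); rewrite f_invF.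
  by have /perm_inj : t (inr x) = t (inl z) by rewrite e fE zy.
pose g x := if t (inr x) is inr y then y else x.
have gE x : t (inr x) = inr (g x) by rewrite /g; have [y ->] := t_inr x.
have g_inj : injective g by move=> x y e; apply/inr_inj/(@perm_inj _ t); rewrite !gE e.
exists (perm f_inj), (perm g_inj); split=> [x|x|]; rewrite ?permE //.
rewrite -odd_lift_inl -odd_lift_inr -odd_permM; congr odd_perm.
by apply/permP => -[x|x]; rewrite permM !permE //= permE ?fE ?gE.
Qed.

End LiftSign.

Lemma inj_inl_sum k (F : 'I_k + 'I_k -> nat) :
  (\sum_c F (inl c) = \sum_(z in [set inl c | c : 'I_k]) F z)%N.
Proof. by rewrite big_imset //= => x y _ _ []. Qed.

Section Exchange.

Variables (K : fieldType) (k n : nat).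
Hypothesis K0 : [pchar K] =i pred0.

(** Solve the Garnir relation for the product of the two forms: all other terms have a left column
    of smaller sum. An arbitrary linear property [V] lets the exchange take place inside a longer
    product. *)
Lemma pluckerM_exchange (V : {mpoly K[k * n]} -> Prop) (I J : ksubset k n)
    (r : 'I_k) :
  V 0 -> (forall f g, V f -> V g -> V (f + g)) ->
  (forall (c : K) f, V f -> V (c *: f)) ->
  (kcol J r < kcol I r)%N ->
  (forall I' J', (ksum I' < ksum I)%N -> (ksum I' + ksum J' = ksum I + ksum J)%N ->
     V (plucker K I' * plucker K J')) ->
  V (plucker K I * plucker K J).
Proof.
move=> V0 VD VZ ltr Vgen.
pose h (z : 'I_k + 'I_k) := match z with inl c => kcol I c | inr c => kcol J c end.
(* Left positions from row [r] on and right positions up to row [r]: each row contributes one and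
   row [r] two, so k + 1 in all. Every left entry here exceeds every right one. *)
pose W : {set 'I_k + 'I_k} :=
  [set z : 'I_k + 'I_k | match z with inl c => (r <= c)%N | inr c => (c <= r)%N end].
have ltkW : (k < #|W|)%N.
  rewrite -sum1_card big_mkcond big_sumType /= -big_split /=.
  apply: (@leq_trans (\sum_(c < k) (1 + (c == r)))%N).
    rewrite big_split /= sum1_card card_ord (bigD1 r) //= eqxx; lia.
  apply: leq_sum => c _; rewrite !inE -val_eqE /=.
  by case: (ltngtP r c) => //.
have := garnir K0 h ltkW.
(* A good [t] rearranges each column within itself; the two reordering signs cancel its sign, so it
   contributes the original product. The identity is good, so the number of such [t] is nonzero in
   characteristic 0. *)
pose good (t : {perm 'I_k + 'I_k}) :=
  [forall c, if t (inl c) is inl _ then true else false].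
rewrite (bigID good) /=.
have goodE (t : {perm 'I_k + 'I_k}) : good t ->
  (-1) ^+ t * (col_minor K (fun c => h (t (inl c))) *
               col_minor K (fun c => h (t (inr c)))) = plucker K I * plucker K J.
  move=> /forallP gt; have [|s [u [tl tr ->]]] := @odd_split _ t.
    by move=> c; have := gt c; case: (t _) => // y _; exists y.
  rewrite (@eq_col_minor _ _ _ (fun c => h (t (inl c))) (kcol I \o s)) =>
    [|c]; last by rewrite tl.
  rewrite (@eq_col_minor _ _ _ (fun c => h (t (inr c))) (kcol J \o u)) =>
    [|c]; last by rewrite tr.
  by rewrite !col_minorM_perm mulrACA -signr_addb signrMK.
rewrite (eq_bigr (fun=> plucker K I * plucker K J)) => [|t /andP[_ /goodE] //].
rewrite sumr_const; set N := #|_|; set B := \sum_(t | _) _.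
have : (0 < N)%N.
  apply/card_gt0P; exists 1%g; rewrite unfold_in perm_on1.
  by apply/forallP => c; rewrite perm1.
move: N => [//|N] _ eqB.
have -> : plucker K I * plucker K J = - (N.+1%:R)^-1 *: B.
  have nzN : (N.+1%:R : K) != 0 by rewrite ((pcharf0P _).1 K0).
  apply: (scalerI nzN); rewrite scalerA mulrN mulfV // scaleN1r scaler_nat.
  by apply/eqP; rewrite -addr_eq0 eqB.
apply: (VZ _ _ _); apply: big_ind => // t /andP[tW bad_t].
have VM1 f (b : bool) : V f -> V ((-1) ^+ b * f).
  by case: b; rewrite ?mul1r // mulN1r -scaleN1r; apply: VZ.
apply: (VM1 _ _ _).
have total : (\sum_c h (t (inl c)) + \sum_c h (t (inr c)) = ksum I + ksum J)%N.
  rewrite -(big_sumType _ (fun=> true) (fun z => h (t z) : nat)).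
  by rewrite -(reindex_inj (@perm_inj _ t) (P := fun=> true) 
    (F := fun z => h z : nat)) big_sumType.
(* A bad [t] trades entries within [W]: those leaving the left column are at least [kcol I r], those
   entering at most [kcol J r], and equally many move each way. *)
have less : (\sum_c h (t (inl c)) < ksum I)%N.
  pose L := [set inl c | c : 'I_k] : {set 'I_k + 'I_k}; pose A := t @: L.
  have -> : (\sum_c h (t (inl c)) = \sum_(z in A) h z)%N.
    rewrite (inj_inl_sum (fun z => h (t z) : nat)).
    by rewrite [RHS]big_imset //= => x y _ _ /perm_inj.
  have -> : (ksum I = \sum_(z in L) h z)%N by rewrite -(inj_inl_sum (fun z => h z : nat)).
  rewrite (big_setID L) /= [X in (_ < X)%N](big_setID A) /= setIC ltn_add2l.
  have cardE : #|A :\: L| = #|L :\: A|.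
    have cA : #|A| = #|L| by rewrite card_imset //; exact: perm_inj.
    by have := cardsID L A; have := cardsID A L; rewrite setIC; lia.
  have AL0 : (0 < #|A :\: L|)%N.
    case/forallPn: bad_t => c; case e: (t (inl c)) => [//|y] _.
    apply/card_gt0P; exists (inr y); rewrite inE -e; apply/andP; split.
      by rewrite e; apply/imsetP => -[].
    by apply/imset_f/imset_f.
  have outW z : z \notin W -> t z = z by apply: out_perm.
  have leAL : (\sum_(z in A :\: L) h z <= #|A :\: L| * (kcol I r).-1)%N.
    rewrite -sum_nat_const; apply: leq_sum => z /setDP[/imsetP[y yL ->] tyL].
    have yW : y \in W.
      by apply: contraNT tyL => /outW ->.
    have : t y \in W by rewrite perm_closed.
    case e: (t y) => [c|c]; rewrite inE /=.
      by case/negP: tyL; rewrite e; apply: imset_f.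
    move=> lecr; have : (kcol J c <= kcol J r)%N.
      move: lecr; rewrite leq_eqVlt => /orP[/eqP/val_inj ->//|].
      by move=> /(kcol_lt J)/ltnW.
    by lia.
  have leLA : (#|L :\: A| * kcol I r <= \sum_(z in L :\: A) h z)%N.
    rewrite -sum_nat_const; apply: leq_sum => z /setDP[zL zA].
    have : z \in W.
      by apply: contraNT zA => /outW e; rewrite -e; apply: imset_f.
    case/imsetP: zL => c _ ->; rewrite inE /=.
    rewrite leq_eqVlt => /orP[/eqP/val_inj ->//|].
    by move=> /(kcol_lt I)/ltnW.
  rewrite cardE in AL0 leAL; apply: leq_ltn_trans leAL (leq_trans _ leLA).
  by rewrite ltn_pmul2l // prednK //; apply: leq_ltn_trans ltr.
have [->|[I' [b [-> sI]]]] := @col_minorP K _ _ (fun c => h (t (inl c))).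
  by rewrite mul0r.
have [->|[J' [b' [-> sJ]]]] := @col_minorP K _ _ (fun c => h (t (inr c))).
  by rewrite mulr0.
rewrite mulrACA -signr_addb; apply/VM1/Vgen; rewrite sI ?sJ; first exact: less.
exact: total.
Qed.

End Exchange.

(** * Spans and leading monomials *)

Section Span.

Variables (K : fieldType) (V : lmodType K) (X : eqType) (F : X -> V).

(** Distinct indices keep a member from occurring twice, which the comparison of leading monomials
    relies on. *)
Definition in_span (Q : X -> Prop) (f : V) : Prop :=
  exists (s : seq X) (c : X -> K),
    [/\ uniq s, {in s, forall i, Q i} & f = \sum_(i <- s) c i *: F i].

Implicit Type Q : X -> Prop.

Lemma in_span0 Q : in_span Q 0.
Proof. by exists [::], (fun=> 0); rewrite big_nil. Qed.

Lemma in_span_gen Q i : Q i -> in_span Q (F i).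
Proof.
by exists [:: i], (fun=> 1); split=> // [j /[!inE]/eqP->|] //; rewrite big_seq1 scale1r.
Qed.

Lemma in_spanZ Q c f : in_span Q f -> in_span Q (c *: f).
Proof.
case=> s [d [us Qs ->]]; exists s, (fun i => c * d i); split=> //.
by rewrite scaler_sumr; apply: eq_bigr => i _; rewrite scalerA.
Qed.

Lemma in_spanD Q f g : in_span Q f -> in_span Q g -> in_span Q (f + g).
Proof.
case=> s [c [us Qs ->]] [t [d [ut Qt ->]]].
(* Both combinations are padded with zero coefficients to the union of their index lists. *)
have widen (r r' : seq X) (e : X -> K) : uniq r -> uniq r' -> {subset r <= r'} ->
    \sum_(i <- r) e i *: F i = \sum_(i <- r') (if i \in r then e i else 0) *: F i.
  move=> ur ur' sub; rewrite [RHS](eq_bigr (fun i => if i \in r then e i *: F i else 0)).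
    rewrite -[RHS]big_mkcond -[RHS]big_filter; apply: perm_big; apply: uniq_perm => //.
      exact: filter_uniq.
    by move=> i; rewrite mem_filter andb_idr //; exact: sub.
  by move=> i _; case: ifP; rewrite ?scale0r.
have sub1 : {subset s <= undup (s ++ t)} by move=> i si; rewrite mem_undup mem_cat si.
have sub2 : {subset t <= undup (s ++ t)}.
  by move=> i ti; rewrite mem_undup mem_cat ti orbT.
exists (undup (s ++ t)).
exists (fun i => (if i \in s then c i else 0) + (if i \in t then d i else 0)).
split; first exact: undup_uniq.
  by move=> i; rewrite mem_undup mem_cat => /orP[/Qs|/Qt].
rewrite (widen _ _ _ us (undup_uniq _) sub1) (widen _ _ _ ut (undup_uniq _) sub2).
by rewrite -big_split; apply: eq_bigr => i _; rewrite scalerDl.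
Qed.

Lemma in_span_min Q (P : V -> Prop) f :
  P 0 -> (forall g h, P g -> P h -> P (g + h)) ->
  (forall (c : K) g, P g -> P (c *: g)) -> (forall i, Q i -> P (F i)) ->
  in_span Q f -> P f.
Proof.
move=> P0 PD PZ PF [s [c [_ Qs ->]]]; rewrite big_seq; apply: big_ind => // i si.
by apply/PZ/PF/Qs.
Qed.

Lemma in_span_trans Q Q' f :
  (forall i, Q i -> in_span Q' (F i)) -> in_span Q f -> in_span Q' f.
Proof.
move=> QQ'; apply: in_span_min => //; [exact: in_span0| |].
- by move=> g h; apply: in_spanD.
- by move=> c g; apply: in_spanZ.
Qed.

End Span.

Section Lead.

Variables (K : fieldType) (k n : nat) (M : 'M[nat]_(k, n)).

Notation wt := (monom_weight M).
Implicit Types (f g : {mpoly K[k * n]}) (m : 'X_{1..k * n}).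

Lemma monom_weightD m m' : wt (m + m')%MM = (wt m + wt m')%N.
Proof.
rewrite /monom_weight -big_split; apply: eq_bigr => i _.
by rewrite -big_split; apply: eq_bigr => j _; rewrite mnmDE mulnDr.
Qed.

Definition weight_ge w f := {in msupp f, forall m, (w <= wt m)%N}.

Lemma weight_geD w f g : weight_ge w f -> weight_ge w g -> weight_ge w (f + g).
Proof. by move=> fw gw m /msuppD_le; rewrite mem_cat => /orP[/fw|/gw]. Qed.

Lemma weight_geM w v f g : weight_ge w f -> weight_ge v g -> weight_ge (w + v) (f * g).
Proof.
move=> fw gv m /msuppM_le/allpairsP[[m1 m2] /= [/fw le1 /gv le2 ->]].
by rewrite monom_weightD leq_add.
Qed.

Lemma weight_geX c m : weight_ge (wt m) (c *: 'X_[m]).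
Proof. by move=> m' /msuppZ_le; rewrite msuppX inE => /eqP->. Qed.

(** For nonzero [c] this says that the initial form of [f] is [c *: 'X_[m]]; stated through the
    remainder, it passes to products directly. *)
Definition leads f c m := weight_ge (wt m).+1 (f - c *: 'X_[m]).

Lemma leads_ge f c m : leads f c m -> weight_ge (wt m) f.
Proof.
move=> lf; rewrite -[f](subrK (c *: 'X_[m])); apply: weight_geD; last exact: weight_geX.
by move=> m' /lf/ltnW.
Qed.

Lemma leads_coef f c m m' : leads f c m -> (wt m' <= wt m)%N ->
  f@_m' = c * (m == m')%:R.
Proof.
move=> lf le_m'; rewrite -mcoeffX -mcoeffZ; apply/eqP; rewrite -subr_eq0 -mcoeffB.
by apply: contraTT le_m'; rewrite -mcoeff_msupp -ltnNge => /lf.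
Qed.

Lemma leads_mul f g c d m m' : leads f c m -> leads g d m' ->
  leads (f * g) (c * d) (m + m')%MM.
Proof.
move=> lf lg; rewrite /leads monom_weightD.
have -> : f * g - (c * d) *: 'X_[m + m'] =
    (f - c *: 'X_[m]) * g + (c *: 'X_[m]) * (g - d *: 'X_[m']).
  rewrite mpolyXD mulrBl mulrBr addrA subrK -scalerAl -scalerAr scalerA.
  by rewrite scalerAl.
apply: weight_geD; first by rewrite -addSn; apply: weight_geM lf (leads_ge lg).
by rewrite -addnS; apply: weight_geM => //; exact: weight_geX.
Qed.

Lemma leads1 : leads 1 1 0%MM.
Proof. by move=> m; rewrite mpolyX0 scale1r subrr msupp0. Qed.

Lemma initial_form_coef f m :
  (initial_form M f)@_m =
  if all (fun m' => wt m <= wt m')%N (msupp f) then f@_m else 0.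
Proof.
rewrite /initial_form raddf_sum /= big_mkcond /=.
have [mf|mNf] := boolP (m \in msupp f).
  rewrite (bigD1_seq m) //= [X in _ + X]big1 => [|m' nem].
    by rewrite mcoeffZ mcoeffX eqxx mulr1 addr0.
  by rewrite mcoeffZ mcoeffX (negPf nem) mulr0; case: ifP.
rewrite (memN_msupp_eq0 mNf) if_same big_seq big1 // => m' m'f.
rewrite mcoeffZ mcoeffX; case: eqP => [e|_]; last by rewrite mulr0; case: ifP.
by rewrite -e m'f in mNf.
Qed.

Lemma initial_form_leads f c m : c != 0 ->
  initial_form M f = c *: 'X_[m] -> leads f c m.
Proof.
move=> nzc fE; have coefE m' := initial_form_coef f m'.
rewrite fE in coefE; have := coefE m; rewrite mcoeffZ mcoeffX eqxx mulr1.
case: ifP => [/allP min_m fm|_ c0]; last by rewrite c0 eqxx in nzc.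
move=> m'; rewrite mcoeff_msupp mcoeffB mcoeffZ mcoeffX.
have [<-|nem] := eqVneq m m'; first by rewrite mulr1 -fm subrr eqxx.
rewrite mulr0 subr0 => nzfm'.
have m'f : m' \in msupp f by rewrite mcoeff_msupp.
rewrite ltn_neqAle min_m // andbT; apply/eqP => ewt.
have := coefE m'; rewrite mcoeffZ mcoeffX (negPf nem) mulr0 -ewt.
by rewrite (introT allP min_m) => f0; rewrite -f0 eqxx in nzfm'.
Qed.

Section Family.

Variables (X : eqType) (F : X -> {mpoly K[k * n]}) (c : X -> K).
Variable mu : X -> 'X_{1..k * n}.
Hypothesis F_leads : forall i, leads (F i) (c i) (mu i).
Hypothesis c_neq0 : forall i, c i != 0.

Variables (s : seq X) (d : X -> K) (f : {mpoly K[k * n]}).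
Hypothesis s_uniq : uniq s.
Hypothesis mu_inj : {in s &, injective mu}.
Hypothesis fE : f = \sum_(i <- s) d i *: F i.

(* A family member of least weight occurring in f cannot have its leading
   monomial cancelled, since the leading monomials are distinct. *)
Lemma leads_sum_ge w i : weight_ge w f -> i \in s -> d i != 0 -> (w <= wt (mu i))%N.
Proof.
move=> fw; have [v] := ubnP (wt (mu i)); elim: v i => // v IHv i /ltnSE le_v si nzd.
rewrite leqNgt; apply/negP => ltw.
have d0 j : j \in s -> (wt (mu j) < wt (mu i))%N -> d j = 0.
  move=> sj ltj; apply/eqP; apply: contraTT ltj => nzdj.
  have [ltjv|] := ltnP (wt (mu j)) v; first by have := IHv j ltjv sj nzdj; lia.
  by rewrite -leqNgt; apply: leq_trans.
suff /fw : mu i \in msupp f by rewrite leqNgt ltw.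
rewrite mcoeff_msupp fE raddf_sum /= (bigD1_seq i) //= big_seq_cond big1.
  by rewrite addr0 mcoeffZ (leads_coef (@F_leads i)) // eqxx mulr1 mulf_neq0.
move=> j /andP[sj neji]; rewrite mcoeffZ.
have [/(d0 _ sj)->|le] := ltnP (wt (mu j)) (wt (mu i)); first by rewrite mul0r.
rewrite (leads_coef (@F_leads j)) // (inj_in_eq mu_inj) // (negPf neji).
by rewrite mulr0 mulr0.
Qed.

(** By [leads_sum_ge] no occurring member starts below the least weight of [f], so the part of that
    weight collects leading terms only. *)
Lemma initial_form_sum : f != 0 -> exists w,
  initial_form M f = \sum_(i <- s | wt (mu i) == w) d i *: (c i *: 'X_[mu i]).
Proof.
move=> nzf.
have [m mf min_m] : exists2 m, m \in msupp f &
    {in msupp f, forall m', (wt m <= wt m')%N}.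
  (* [mlead f] only supplies some monomial of [f], from which the weight descends to its minimum. *)
  have := mlead_supp nzf; have [v] := ubnP (wt (mlead f)).
  elim: v (mlead f) => // v IHv m /ltnSE le_v mf.
  have [/hasP[m' m'f ltm]|] := boolP (has (fun m' => wt m' < wt m)%N (msupp f)).
    by apply: IHv m'f; apply: leq_trans ltm le_v.
  by move=> /hasPn minm; exists m => // m' /minm; rewrite -leqNgt.
exists (wt m); apply/mpolyP => m'; rewrite initial_form_coef raddf_sum /=.
have [ewt|newt] := eqVneq (wt m') (wt m).
  rewrite ewt (introT allP min_m) fE raddf_sum /= [RHS]big_mkcond /=.
  apply: eq_big_seq => i si; rewrite !mcoeffZ mcoeffX.
  have [->|nzd] := eqVneq (d i) 0; first by rewrite !mul0r; case: ifP.
  have le_i := leads_sum_ge min_m si nzd.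
  rewrite (leads_coef (@F_leads i)) ?ewt //; case: ifPn => // nei.
  by case: eqP => [e|_]; [rewrite e ewt eqxx in nei | rewrite !mulr0].
rewrite big1 => [|i /eqP ei].
  case: ifP => // /allP le_m'; apply/eqP; apply: contraNT newt.
  rewrite -mcoeff_msupp => m'f.
  by rewrite eqn_leq min_m // le_m'.
rewrite !mcoeffZ mcoeffX; case: eqP => [e|]; last by rewrite !mulr0.
by rewrite -e ei eqxx in newt.
Qed.

End Family.

End Lead.

(** * Straightening *)

Section Straightening.

Variables (K : fieldType) (k n : nat).
Hypothesis K0 : [pchar K] =i pred0.

Notation tab := (seq (ksubset k n)).

Definition plucker_prod (S : tab) : {mpoly K[k * n]} := \prod_(I <- S) plucker K I.

(** Columns increase strictly by construction, so [sorted kle] is semistandardness. *)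
Definition kle (I J : ksubset k n) := [forall c, kcol I c <= kcol J c]%N.

Lemma not_sorted_split (T : Type) (e : rel T) (s : seq T) : ~~ sorted e s ->
  exists s1 x y s2, s = s1 ++ x :: y :: s2 /\ ~~ e x y.
Proof.
elim: s => [//|x [//|y s] IHs] /=; have [exy /= /IHs|nexy _] := boolP (e x y).
  by case=> s1 [x' [y' [s2 [-> ne]]]]; exists (x :: s1), x', y', s2.
by exists [::], x, y, s.
Qed.

(** Earlier columns weigh more, so moving part of the entry sum from a column to the next one lowers
    this measure. *)
Fixpoint disorder (S : tab) : nat :=
  if S is A :: S' then (ksum A * size S + disorder S')%N else 0%N.

(** Two adjacent columns that violate [kle] in some row admit an exchange there; it keeps their
    total sum, lowers the left one and hence lowers [disorder]. *)
Lemma straightening (S : tab) :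
  in_span plucker_prod (fun T => sorted kle T /\ size T = size S) (plucker_prod S).
Proof.
have [v] := ubnP (disorder S); elim: v S => // v IHv S /ltnSE le_v.
have [sS|/not_sorted_split[S1 [I [J [S2 [eS nIJ]]]]]] := boolP (sorted kle S).
  exact: in_span_gen.
have [r ltr] : exists r, (kcol J r < kcol I r)%N.
  by case/forallPn: nIJ => r; rewrite -ltnNge; exists r.
pose Q (T : tab) := sorted kle T /\ size T = size S.
have catE I' J' : plucker_prod S1 * (plucker K I' * plucker K J') * plucker_prod S2 =
    plucker_prod (S1 ++ I' :: J' :: S2).
  by rewrite /plucker_prod big_cat !big_cons /= -!mulrA.
rewrite eS -catE -eS.
apply: (@pluckerM_exchange _ _ _ K0
  (fun f => in_span plucker_prod Q (plucker_prod S1 * f * plucker_prod S2)) I J r) => //.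
- by rewrite mulr0 mul0r; apply: in_span0.
- by move=> f g fQ gQ; rewrite mulrDr mulrDl; apply: in_spanD.
- by move=> c f fQ; rewrite -scalerAr -scalerAl; apply: in_spanZ.
move=> I' J' ltI eIJ; rewrite catE.
have sE : size (S1 ++ I' :: J' :: S2) = size S by rewrite eS !size_cat.
rewrite /Q -sE; apply: IHv; apply: leq_trans le_v; rewrite eS.
elim: (S1) => [|A S1' IH] /=; last by rewrite !size_cat /= in IH *; lia.
by nia.
Qed.

End Straightening.

(** * Tableau monomials *)

Section Monomials.

Variables (k n : nat).

Notation tab := (seq (ksubset k n)).

Definition field_mon l (I : ksubset k n) : 'X_{1..k * n} :=
  (\sum_(c < k) U_(mxvec_index (block_field l I c) (kcol I c)))%MM.

Definition tab_mon l (S : tab) : 'X_{1..k * n} := (\sum_(I <- S) field_mon l I)%MM.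

(** The field sends positions in a column to rows, so its inverse finds the entry lying in row
    [i]. *)
Lemma tab_mon_coef l S i j :
  tab_mon l S (mxvec_index i j) =
  count (fun I => kcol I ((block_field l I)^-1%g i) == j) S.
Proof.
rewrite /tab_mon mnm_sumE -sum1_count [RHS]big_mkcond; apply: eq_bigr => I _.
rewrite mnm_sumE (bigD1 ((block_field l I)^-1%g i)) //= big1 => [|c nec].
  by rewrite mnm1E permKV mxvec_index_eq eqxx addn0; case: eqP.
rewrite mnm1E mxvec_index_eq; case: eqP => // e.
by rewrite -e permK eqxx in nec.
Qed.

Lemma eq_tab_mon l l' (S T : tab) :
  (forall i j, count (fun I => kcol I ((block_field l I)^-1%g i) == j) S =
               count (fun I => kcol I ((block_field l' I)^-1%g i) == j) T) ->
  tab_mon l S = tab_mon l' T.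
Proof.
by move=> e; apply/mnmP => x; case/mxvec_indexP: x => i j; rewrite !tab_mon_coef e.
Qed.

Lemma block_field0 (I : ksubset k n) : block_field 0 I = 1%g.
Proof.
rewrite /block_field (_ : [set j in val I | (j < 0)%N] = set0) ?cards0 ?orbT //.
by apply/setP => j; rewrite !inE andbF.
Qed.

Lemma tab_mon0_coef S i j :
  tab_mon 0 S (mxvec_index i j) = count (fun I => kcol I i == j) S.
Proof. by rewrite tab_mon_coef; apply: eq_count => I; rewrite block_field0 invg1 perm1. Qed.

Lemma tab_mon_size l l' S T : (0 < k)%N ->
  tab_mon l S = tab_mon l' T -> size S = size T.
Proof.
move=> k0 /(congr1 mdeg); have degE l0 R : mdeg (tab_mon l0 R) = (size R * k)%N.
  rewrite /tab_mon mdeg_sum (eq_bigr (fun=> k)) => [|I _].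
    by rewrite big_const_seq count_predT iter_addn_0 mulnC.
  rewrite mdeg_sum (eq_bigr (fun=> 1%N)) ?sum_nat_const ?card_ord ?muln1 //.
  by move=> c _; rewrite mdeg1.
by rewrite !degE => /eqP; rewrite eqn_pmul2r // => /eqP.
Qed.

Lemma perm_tab_mon l S T : perm_eq S T -> tab_mon l S = tab_mon l T.
Proof. exact: perm_big. Qed.

(** For l = 0 the exponents record the contents of each row, and a weakly increasing row is
    determined by its contents. *)
Lemma sorted_tab_mon_inj S T : (0 < k)%N -> sorted (@kle k n) S -> sorted (@kle k n) T ->
  tab_mon 0 S = tab_mon 0 T -> S = T.
Proof.
move=> k0 sS sT eST.
have rowE i : [seq kcol A i | A <- S] = [seq kcol A i | A <- T].
  have sorted_row R : sorted (@kle k n) R ->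
      sorted (fun a b : 'I_n => a <= b)%N [seq kcol A i | A <- R].
    by rewrite sorted_map; apply: sub_sorted => A B /forallP/(_ i).
  apply: (sorted_eq (leT := fun a b : 'I_n => a <= b)%N); try exact: sorted_row.
  - by move=> a b c; apply: leq_trans.
  - by move=> a b /anti_leq/val_inj.
  apply/allP => j _; apply/eqP; rewrite !count_map.
  have := congr1 (fun m : 'X_{1..k * n} => m (mxvec_index i j)) eST.
  by rewrite /= !tab_mon0_coef.
elim: S T {sS sT eST} rowE => [|I S IHS] [|J T] rowE //.
- by have := rowE (Ordinal k0).
- by have := rowE (Ordinal k0).
congr (_ :: _).
  by apply: ksubset_ext => i; have [] := rowE i.
by apply: IHS => i; have [] := rowE i.
Qed.

(** * Cheapest representatives of the row-content classes *)

Section Canonical.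

Variable cost : ksubset k n -> nat.

(** Tuples of a fixed length form a finite type; for positive [k], equal monomials force equal
    lengths anyway. *)
Definition cheapest (m : 'X_{1..k * n}) (N : tab) : bool :=
  (tab_mon 0 N == m) &&
  [forall T : (size N).-tuple (ksubset k n), (tab_mon 0 T == m) ==>
     (\sum_(I <- N) cost I <= \sum_(I <- T) cost I)%N].

(** [choose] returns the same witness whichever valid one it is given, so ties between cheapest
    tableaux are broken uniformly within a class. *)
Definition canonical_tab (N : tab) : bool :=
  cheapest (tab_mon 0 N) N && (N == choose (cheapest (tab_mon 0 N)) N).

Lemma canonical_tab_inj N N' : canonical_tab N -> canonical_tab N' ->
  tab_mon 0 N = tab_mon 0 N' -> N = N'.
Proof.
move=> /andP[cN /eqP eN] /andP[cN' /eqP eN'] e.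
apply: etrans eN (etrans _ (esym eN')); rewrite e; apply: choose_id => //.
by rewrite -e.
Qed.

Lemma canonical_tab_exists S : exists2 N, canonical_tab N & tab_mon 0 N = tab_mon 0 S.
Proof.
pose P (T : (size S).-tuple (ksubset k n)) := tab_mon 0 T == tab_mon 0 S.
have PS : P (in_tuple S) by rewrite /P.
case: (arg_minnP (fun T : (size S).-tuple _ => \sum_(I <- T) cost I)%N PS) => T PT minT.
have cT : cheapest (tab_mon 0 S) T.
  apply/andP; split=> //; apply/forallP => T'; apply/implyP => PT'.
  have szT' : size T' == size S by rewrite !size_tuple.
  exact: (minT (Tuple szT')).
exists (choose (cheapest (tab_mon 0 S)) T); last first.
  by have /andP[/eqP] := chooseP cT.
have cN := chooseP cT; have /andP[/eqP eN _] := cN.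
by rewrite /canonical_tab eN cN /=; apply/eqP/choose_id.
Qed.

End Canonical.

End Monomials.

(** * Uncrossing the first two rows *)

Section TwoRows.

Variables (k n l : nat).

Notation tab := (seq (ksubset k.+2 n)).
Notation o1 := (lift ord0 ord0 : 'I_k.+2).

Definition top_pair (I : ksubset k.+2 n) : nat * nat :=
  (nat_of_ord (kcol I ord0), nat_of_ord (kcol I o1)).

(** By the rearrangement inequality the total drops when crossing pairs (a, b), (a', b') with a < a'
    < b < b' become (a', b), (a, b'). *)
Definition top_product (I : ksubset k.+2 n) : nat := (kcol I ord0 * kcol I o1)%N.

Lemma ord_two_cases (c : 'I_k.+2) : [\/ c = ord0, c = o1 | (o1 < c)%N].
Proof.
case: c => [[|[|m]] ltm]; first by constructor 1; apply: val_inj.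
  by constructor 2; apply: val_inj.
by constructor 3.
Qed.

Lemma top_pair_lt (I : ksubset k.+2 n) : ((top_pair I).1 < (top_pair I).2 < n)%N.
Proof. by rewrite /top_pair /= ltn_ord andbT; apply: kcol_lt. Qed.

(** Entries increase along a column, so exactly one lies in the first block when the first entry
    does and the second does not. *)
Lemma block_field_mixed (I : ksubset k.+2 n) :
  block_field l I = if mixed l (top_pair I) then tperm ord0 o1 else 1%g.
Proof.
have lt01 : (kcol I ord0 < kcol I o1)%N by apply: kcol_lt.
have setE : [set j in val I | (j < l)%N] = kcol I @: [set c | (kcol I c < l)%N].
  apply/setP => j; apply/idP/imsetP; rewrite !inE.
    by case/andP => /kcol_surj[c ->] ltc; exists c; rewrite ?inE.
  by case=> c; rewrite inE => ltc ->; rewrite mem_kcol.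
rewrite /block_field (eqP (valP I)) setE card_imset; last exact: kcol_inj.
rewrite /mixed /=; have [/andP[lt0 ge1]|not_mixed] := ifPn (_ < l <= _)%N.
  rewrite (_ : [set c | _] = [set ord0]) ?cards1 //; apply/setP => c; rewrite !inE.
  have [->|->|lt1c] := ord_two_cases c; first by rewrite lt0 eqxx.
    by rewrite ltnNge ge1.
  rewrite ltnNge (leq_trans ge1) /=; last exact/ltnW/kcol_lt.
  by apply/esym/eqP => ec; rewrite ec in lt1c.
case: eqP => //= /eqP/cards1P[c cE]; case/negP: not_mixed.
have ltc : (kcol I c < l)%N by have := set11 c; rewrite -cE inE.
have lt0 : (kcol I ord0 < l)%N.
  by move: ltc; have [->|->|/(kcol_lt I)] := ord_two_cases c; lia.
rewrite lt0 leqNgt; apply/negP => lt1.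
have /set1P e0 : ord0 \in [set c] by rewrite -cE inE.
have /set1P e1 : o1 \in [set c] by rewrite -cE inE.
by have := lt01; rewrite e1 e0 ltnn.
Qed.

Lemma block_field_slot1 (I : ksubset k.+2 n) :
  (kcol I ((block_field l I)^-1%g ord0) : nat) = slot1 l (top_pair I).
Proof.
rewrite block_field_mixed /slot1.
by case: ifP; rewrite ?tpermV ?tpermL ?invg1 ?perm1.
Qed.

Lemma block_field_slot2 (I : ksubset k.+2 n) :
  (kcol I ((block_field l I)^-1%g o1) : nat) = slot2 l (top_pair I).
Proof.
rewrite block_field_mixed /slot2.
by case: ifP; rewrite ?tpermV ?tpermR ?invg1 ?perm1.
Qed.

Lemma block_field_fix (I : ksubset k.+2 n) (i : 'I_k.+2) :
  (o1 < i)%N -> (block_field l I)^-1%g i = i.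
Proof.
move=> lt1i; rewrite block_field_mixed; case: ifP; rewrite ?invg1 ?perm1 // tpermV.
by rewrite tpermD //; apply: contraTneq lt1i => <-.
Qed.

(* Exchanging the first entries of two columns with crossing top pairs keeps
   all row contents and makes the tableau cheaper. *)
Lemma canonical_noncrossing (N : tab) :
  canonical_tab top_product N -> noncrossing (map top_pair N).
Proof.
case/andP => /andP[_ /forallP minN] _ _ _ /mapP[I IN ->] /mapP[J JN ->] /=.
set aI := kcol I ord0; set aJ := kcol J ord0; set bI := kcol I o1; set bJ := kcol J o1.
case/andP => lt_a ltJI; rewrite leqNgt; apply/negP => lt_b.
have neJI : J != I by apply: contraTneq lt_a => e; rewrite /aI /aJ e ltnn.
pose R := rem J (rem I N).
have permN : perm_eq N [:: I, J & R].
  apply: perm_trans (perm_to_rem IN) _; rewrite perm_cons; apply: perm_to_rem.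
  by rewrite rem_mem.
have incr (A : ksubset k.+2 n) (a : 'I_n) : (a < kcol A o1)%N ->
    exists B : ksubset k.+2 n, kcol B =1 fun c => if c == ord0 then a else kcol A c.
  move=> lta; apply: incr_kcol => c d ltcd.
  have -> : (d == ord0) = false by apply/eqP => e; rewrite e in ltcd.
  case: eqP => [_|_]; last exact: kcol_lt.
  have [e|->|/(kcol_lt A)] := ord_two_cases d => //; last exact: ltn_trans.
  by rewrite e in ltcd.
have [|I1 I1E] := incr I aJ; first exact: ltJI.
have [|J1 J1E] := incr J aI; first exact: (ltn_trans lt_a (kcol_lt J _)).
have sE : size [:: I1, J1 & R] == size N by rewrite (perm_size permN).
have := minN (Tuple sE); rewrite /= (_ : tab_mon 0 _ == _); last first.
  apply/eqP; rewrite (perm_tab_mon _ permN); apply: eq_tab_mon => i j /=.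
  rewrite !block_field0 !invg1 !perm1 I1E J1E !addnA; congr (_ + _)%N.
  by have [->|_] := eqVneq i ord0; rewrite // addnC.
rewrite (perm_big _ permN) /= !big_cons /top_product !I1E !J1E /=.
have rearrange (a a' b b' r : nat) : (a < a')%N -> (b < b')%N ->
    (a * b + (a' * b' + r) <= a' * b + (a * b' + r))%N -> False.
  by nia.
exact: rearrange lt_a lt_b.
Qed.

(** The first two rows of [tab_mon l] list the slots of the top pairs, from which
    [noncrossing_slots] recovers the original two rows; the field fixes all other rows. *)
Lemma noncrossing_tab_mon (N N' : tab) : (l <= n)%N ->
  noncrossing (map top_pair N) -> noncrossing (map top_pair N') ->
  tab_mon l N = tab_mon l N' -> tab_mon 0 N = tab_mon 0 N'.
Proof.
move=> le_ln nc nc' eNN'.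
have coefE i j := congr1 (fun m : 'X_{1..k.+2 * n} => m (mxvec_index i j)) eNN'.
have permE (slot : nat * nat -> nat) (i : 'I_k.+2) :
    (forall I, (kcol I ((block_field l I)^-1%g i) : nat) = slot (top_pair I)) ->
    perm_eq (map slot (map top_pair N)) (map slot (map top_pair N')).
  move=> slotE; apply/allP => x _; apply/eqP; rewrite !count_map /=.
  have [ltxn|lenx] := ltnP x n.
    have := coefE i (Ordinal ltxn); rewrite !tab_mon_coef => e.
    have slot_eq (S : tab) : count (fun I => slot (top_pair I) == x) S =
        count (fun I => kcol I ((block_field l I)^-1%g i) == Ordinal ltxn) S.
      by apply: eq_count => I; rewrite -slotE.
    exact: etrans (slot_eq N) (etrans e (esym (slot_eq N'))).
  by rewrite !(@eq_count _ _ pred0) ?count_pred0 // => I /=; rewrite -slotE;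
    apply/eqP => e; rewrite -e leqNgt ltn_ord in lenx.
have lt_pairs (S : tab) : {in map top_pair S, forall p, (p.1 < p.2 < n)%N}.
  by move=> _ /mapP[I _ ->]; exact: top_pair_lt.
have slotsE := noncrossing_slots le_ln nc nc' (lt_pairs N) (lt_pairs N')
  (permE _ _ block_field_slot1) (permE _ _ block_field_slot2).
apply: eq_tab_mon => i j.
have e0 (S : tab) : count (fun I => kcol I ((block_field 0 I)^-1%g i) == j) S =
    count (fun I => kcol I i == j) S.
  by apply: eq_count => I; rewrite block_field0 invg1 perm1.
rewrite !{}e0; have [] := slotsE _ (ltn_ord j); rewrite !count_map.
have [->|->|lt1i] := ord_two_cases i => // _ _.
have := coefE i j; rewrite !tab_mon_coef.
have el (S : tab) : count (fun I => kcol I ((block_field l I)^-1%g i) == j) S =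
    count (fun I => kcol I i == j) S.
  by apply: eq_count => I; rewrite block_field_fix.
by rewrite !el.
Qed.

End TwoRows.

(** With fewer than two rows the field is trivial and there is no pair to uncross, so the cost is
    constant. *)
Definition tab_cost k n : ksubset k n -> nat :=
  match k with
  | k'.+2 => @top_product k' n
  | _ => fun=> 0%N
  end.

Lemma canonical_tab_mon_inj k n l (N N' : seq (ksubset k n)) : (l <= n)%N ->
  canonical_tab (@tab_cost k n) N -> canonical_tab (@tab_cost k n) N' ->
  tab_mon l N = tab_mon l N' -> N = N'.
Proof.
move=> le_ln cN cN' e.
suff : tab_mon 0 N = tab_mon 0 N' by exact: canonical_tab_inj cN cN'.
case: k N N' cN cN' e => [|[|k]] N N' cN cN' e.
- by apply: eq_tab_mon => -[].
- have e0 (S : seq (ksubset 1 n)) : tab_mon l S = tab_mon 0 S.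
    apply: eq_tab_mon => i j; apply: eq_count => I.
    by rewrite block_field0 /block_field (eqP (valP I)).
  by rewrite -!e0.
by apply: noncrossing_tab_mon e => //; apply: canonical_noncrossing.
Qed.

(** * Spanning by canonical tableaux, and initial forms *)

Section Leading.

Variables (K : fieldType) (k n : nat).

Notation tab := (seq (ksubset k n)).

Definition tab_sign l (S : tab) : K := \prod_(I <- S) (-1) ^+ block_field l I.

Lemma tab_sign_neq0 l S : tab_sign l S != 0.
Proof. by rewrite prodf_seq_neq0; apply/allP => I _; rewrite signr_eq0. Qed.

Lemma initial_plucker l (I : ksubset k n) : (l <= n)%N ->
  initial_form (block_weight k n l) (plucker K I) =
  (-1) ^+ block_field l I *: 'X_[field_mon l I].
Proof.
move=> le_ln; rewrite block_weight_induces //.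
by rewrite /field_mon (big_morph _ (@mpolyXD _ K) (mpolyX0 _ K)).
Qed.

Lemma plucker_prod_leads l (S : tab) : (l <= n)%N ->
  leads (block_weight k n l) (plucker_prod K S) (tab_sign l S) (tab_mon l S).
Proof.
move=> le_ln; rewrite /plucker_prod /tab_sign /tab_mon.
elim: S => [|I S IHS]; first by rewrite !big_nil; apply: leads1.
rewrite !big_cons; apply: leads_mul IHS.
by apply: initial_form_leads; rewrite ?signr_eq0 ?initial_plucker.
Qed.

Hypothesis K0 : [pchar K] =i pred0.
Hypothesis k_gt0 : (0 < k)%N.

Let M0 := block_weight k n 0.
Let wt0 (S : tab) : nat := monom_weight M0 (tab_mon 0 S).

(** With the number of columns fixed, this bound makes an induction on growing weight terminate. *)
Lemma wt0_le (S : tab) :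
  (wt0 S <= size S * \max_(I : ksubset k n) monom_weight M0 (field_mon 0 I))%N.
Proof.
rewrite /wt0 /tab_mon; elim: S => [|I S IHS].
  rewrite big_nil /monom_weight big1 // => i _.
  by rewrite big1 // => j _; rewrite mnm0E muln0.
by rewrite big_cons monom_weightD mulSn leq_add // (leq_bigmax I).
Qed.

(** Subtracting the product of the canonical tableau with the same row contents cancels the leading
    term; the difference straightens into tableaux of higher weight, to which induction applies. *)
Lemma plucker_prod_canonical_span (S : tab) :
  in_span (@plucker_prod K k n) (canonical_tab (@tab_cost k n)) (plucker_prod K S).
Proof.
set C := (\max_(I : ksubset k n) monom_weight M0 (field_mon 0 I))%N.
have [v] := ubnP (size S * C - wt0 S)%N; elim: v S => // v IHv S /ltnSE le_v.
have [N cN eN] := canonical_tab_exists (@tab_cost k n) S.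
have szN : size N = size S := tab_mon_size k_gt0 eN.
(* For l = 0 every sign is 1, so the two leading terms agree exactly and not merely up to sign. *)
have sign0 T : tab_sign 0 T = 1.
  by rewrite /tab_sign big1 // => I _; rewrite block_field0 odd_perm1.
have lead T : leads M0 (plucker_prod K T) 1 (tab_mon 0 T).
  by rewrite -(sign0 T); apply: plucker_prod_leads.
rewrite -[plucker_prod K S](subrK (plucker_prod K N)).
apply: in_spanD; last exact: in_span_gen.
have higher : weight_ge M0 (wt0 S).+1 (plucker_prod K S - plucker_prod K N).
  rewrite (_ : _ - _ = (plucker_prod K S - 1 *: 'X_[tab_mon 0 S]) -
                       (plucker_prod K N - 1 *: 'X_[tab_mon 0 N])).
    apply: weight_geD; first exact: lead.
    by move=> m; rewrite (perm_mem (msuppN _)); have := lead N; rewrite eN; apply.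
  by rewrite eN opprB addrA subrK.
have : in_span (@plucker_prod K k n) (fun T => sorted (@kle k n) T /\ size T = size S)
    (plucker_prod K S - plucker_prod K N).
  apply: in_spanD; first exact: straightening.
  by rewrite -scaleN1r; apply: in_spanZ; rewrite -szN; apply: straightening.
case=> s [d [us Qs gE]]; rewrite gE big_seq.
apply: big_ind => [|f g|T sT]; [exact: in_span0 | exact: in_spanD |].
have [->|nzd] := eqVneq (d T) 0; first by rewrite scale0r; apply: in_span0.
apply/in_spanZ/IHv; apply: leq_trans le_v; have [_ szT] := Qs T sT.
(* Semistandard tableaux have distinct leading monomials for the weight of l = 0, so none occurring
   here can start below the weight of the difference. *)
have : ((wt0 S).+1 <= wt0 T)%N.
  apply: (leads_sum_ge lead _ us _ gE higher sT nzd) => [|A B /Qs[sA _] /Qs[sB _]].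
    by move=> _; exact: oner_neq0.
  exact: sorted_tab_mon_inj.
by have := wt0_le T; rewrite -/C szT; lia.
Qed.

(** All products of Plücker forms span the algebra, since concatenating tableaux multiplies their
    products; each then reduces to canonical ones. *)
Lemma plucker_algebra_span f :
  @plucker_algebra K k n f ->
  in_span (@plucker_prod K k n) (canonical_tab (@tab_cost k n)) f.
Proof.
move=> Af; apply: (in_span_trans (Q := fun=> True)) => [S _|].
  exact: plucker_prod_canonical_span.
elim: f / Af => [_ [I ->]|c|f g _ fS _ gS|f g _ fS _ gS].
- rewrite (_ : plucker K I = plucker_prod K [:: I]); first exact: in_span_gen.
  by rewrite /plucker_prod big_seq1.
- apply: in_spanZ; rewrite (_ : 1 = plucker_prod K [::]); first exact: in_span_gen.
  by rewrite /plucker_prod big_nil.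
- exact: in_spanD.
pose V (h : {mpoly K[k * n]}) := in_span (@plucker_prod K k n) (fun=> True) (h * g).
apply: (in_span_min (P := V) _ _ _ _ fS); rewrite /V.
- by rewrite mul0r; apply: in_span0.
- by move=> a b aS bS; rewrite mulrDl; apply: in_spanD.
- by move=> c a aS; rewrite -scalerAl; apply: in_spanZ.
move=> S _.
pose W (h : {mpoly K[k * n]}) :=
  in_span (@plucker_prod K k n) (fun=> True) (plucker_prod K S * h).
apply: (in_span_min (P := W) _ _ _ _ gS); rewrite /W.
- by rewrite mulr0; apply: in_span0.
- by move=> a b aS bS; rewrite mulrDr; apply: in_spanD.
- by move=> c a aS; rewrite -scalerAr; apply: in_spanZ.
move=> T _; rewrite (_ : _ * _ = plucker_prod K (S ++ T)); first exact: in_span_gen.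
by rewrite /plucker_prod big_cat.
Qed.

(** Canonical tableaux have distinct leading monomials, so the initial form of [f] combines their
    leading terms, each a product of initial forms of Plücker forms. *)
Lemma initial_form_in_subalg l f : (l <= n)%N -> @plucker_algebra K k n f ->
  gen_subalg (fun h => exists I, h = initial_form (block_weight k n l) (plucker K I))
    (initial_form (block_weight k n l) f).
Proof.
move=> le_ln /plucker_algebra_span[s [d [us cs fE]]].
set G := gen_subalg _.
have GZ c h : G h -> G (c *: h).
  by move=> Gh; rewrite -[h]mul1r scalerAl; apply: GenMul => //; apply: GenScalar.
have G1 : G 1 by rewrite -[1](scale1r); apply: GenScalar.
have G0 : G 0 by rewrite -(scale0r 1); apply: GenScalar.
(* The initial form of 0 is 0 by convention, and 0 lies in every subalgebra. *)
have [f0|nzf] := eqVneq f 0; first by rewrite f0 /initial_form msupp0 big_nil.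
have lead S : leads (block_weight k n l) (plucker_prod K S) (tab_sign l S) (tab_mon l S).
  exact: plucker_prod_leads.
have inj : {in s &, injective (@tab_mon k n l)}.
  by move=> A B /cs cA /cs cB; apply: canonical_tab_mon_inj.
have [w ->] := initial_form_sum lead (@tab_sign_neq0 l) us inj fE nzf.
apply: big_ind => // [a b|S _]; first exact: GenAdd.
apply: GZ; rewrite /tab_sign /tab_mon; elim: S => [|I S IHS].
  by rewrite !big_nil mpolyX0 scale1r.
rewrite !big_cons mpolyXD -scalerA scalerAr scalerAl; apply: GenMul => //.
by apply: GenIncl; exists I; rewrite initial_plucker.
Qed.

End Leading.

Theorem theorem4p3 (K : fieldType) (k n l : nat) :
  [pchar K] =i pred0 ->
  (1 <= k <= n)%N -> (l <= n)%N ->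
  sagbi_basis (block_weight k n l) (@plucker K k n) (@plucker_algebra K k n).
Proof.
move=> K0 /andP[k_gt0 _] le_ln; split=> [I|g].
  exists ((-1) ^+ block_field l I); first by rewrite signr_eq0.
  by exists (field_mon l I); rewrite initial_plucker.
split=> gG; elim: g / gG.
- by move=> _ [f Af ->]; apply: initial_form_in_subalg.
- exact: GenScalar.
- by move=> f h _ Gf _ Gh; apply: GenAdd.
- by move=> f h _ Gf _ Gh; apply: GenMul.
- by move=> _ [I ->]; apply: GenIncl; exists (plucker K I) => //; apply: GenIncl; exists I.
- exact: GenScalar.
- by move=> f h _ Gf _ Gh; apply: GenAdd.
- by move=> f h _ Gf _ Gh; apply: GenMul.
Qed.
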